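(* Let $P\subset\mathbb{R}^2$ be a regular $n$-gon ($n\ge 3$) with center $O$, let $G$ be the rotation group of $P$ (the cyclic group of order $n$ generated by the rotation about $O$ by the angle $2\pi/n$), and let $\mathcal{S}$ be a contractible $G$-symmetric $P$-polygonal system. Let $K$ be the attractor of $\mathcal{S}$ and let $\hat\gamma$ be the main tree of $K$. Then $O$ is the only ramification point of $\hat\gamma$, and $Ord(O,\hat\gamma)=n$.
   Context: Let $P$ be a convex polygon in $\mathbb{R}^2$ with vertex set $V_P=\{A_1,\dots,A_{n_P}\}$. A finite system $\mathcal{S}=\{S_1,\dots,S_m\}$ of contracting similarities of $\mathbb{R}^2$ (put $I=\{1,\dots,m\}$) is a contractible $P$-polygonal system if: (D1) for every $k\in I$, $P_k=S_k(P)\subset P$; (D2) for $i\ne j$ in $I$, $P_i\cap P_j$ is either empty or a single point that is a common vertex of $P_i$ and $P_j$; (D3) for every $A_k\in V_P$ there are $S_i\in\mathcal{S}$ and $A_l\in V_P$ with $S_i(A_l)=A_k$; (D4) $\widetilde P=\bigcup_{i=1}^m P_i$ is contractible. Let $G$ be a non-trivial group of isometries of the plane mapping $P$ onto itself. A contractible $P$-polygonal system $\mathcal{S}$ is called $G$-symmetric if for every $g\in G$ and $S_i\in\mathcal{S}$ there are $g'\in G$ and $S_j\in\mathcal{S}$ with $g\circ S_i=S_j\circ g'$. The attractor of $\mathcal{S}$ is the unique nonempty compact set $K$ with $K=\bigcup_{i=1}^m S_i(K)$. It is known that for a contractible $P$-polygonal system $K$ is a dendrite (a locally connected continuum containing no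 simple closed curve). Hence any two distinct points of $K$ are joined by a unique Jordan arc in $K$. For $i\ne j$ let $\gamma_{ij}\subset K$ be the unique Jordan arc joining $A_i$ and $A_j$. The main tree of $K$ is $\hat\gamma=\bigcup_{i\neq j}\gamma_{ij}$. For a dendrite $X$ and $p\in X$, $Ord(p,X)$ is the number of components of $X\setminus\{p\}$; $p$ is a ramification point of $X$ if $Ord(p,X)\ge 3$. *)

(* Defs.v *)
(* The plane is 'rV[R]_2 for R : realType. *)
From HB Require Import structures.
From mathcomp Require Import all_boot all_order all_algebra.
From mathcomp Require Import all_classical all_reals all_analysis.

Set Implicit Arguments.
Unset Strict Implicit.
Unset Printing Implicit Defensive.

Import Order.TTheory GRing.Theory Num.Theory.
Import numFieldNormedType.Exports.

Local Open Scope classical_set_scope.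
Local Open Scope ring_scope.

Notation plane R := 'rV[R]_2.

(* The library norm on row vectors is the sup norm: it induces the usual
   topology of the plane, but similarities refer to the Euclidean distance. *)
Definition edist (R : realType) (x y : plane R) : R :=
  Num.sqrt (\sum_(i < 2) (x 0 i - y 0 i) ^+ 2).

Definition point (R : realType) (a b : R) : plane R :=
  \row_(i < 2) (if i == 0 then a else b).

Definition contracting_similarity (R : realType) (f : plane R -> plane R) :=
  exists r : R, [/\ 0 < r, r < 1 &
    forall x y, edist (f x) (f y) = r * edist x y].

(* A polygon is given by its family of vertices; as a subset of the plane it is
   the (filled) convex hull of the vertices. *)
Definition polygon (R : realType) (n : nat) (A : 'I_n -> plane R) :
    set (plane R) :=
  [set x | exists w : 'I_n -> R, [/\ forall k, 0 <= w k,
    \sum_k w k = 1 & x = \sum_k w k *: A k]].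

Definition regular_polygon (R : realType) (n : nat) (A : 'I_n -> plane R)
    (O : plane R) :=
  exists r t : R, 0 < r /\ forall k : 'I_n,
    A k = O + r *: point (cos (t + k%:R * (2 * pi / n%:R)))
                         (sin (t + k%:R * (2 * pi / n%:R))).

Definition rotation (R : realType) (O : plane R) (t : R) (x : plane R) :
    plane R :=
  O + point (cos t * (x - O) 0 0 - sin t * (x - O) 0 1)
            (sin t * (x - O) 0 0 + cos t * (x - O) 0 1).

(* The generator has order n, so its natural powers already form a group. *)
Definition rotation_group (R : realType) (n : nat) (O : plane R) :
    set (plane R -> plane R) :=
  [set g | exists k : nat, g = iter k (rotation O (2 * pi / n%:R))].

Definition contractible (R : realType) (X : set (plane R)) :=
  exists (a : plane R) (H : plane R * R -> plane R),
    [/\ X a,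
        {within X `*` `[0, 1], continuous H},
        forall x t, X x -> t \in `[0, 1] -> X (H (x, t)),
        forall x, X x -> H (x, 0) = x &
        forall x, X x -> H (x, 1) = a].

Record contractible_polygonal_system (R : realType) (n m : nat)
    (A : 'I_n -> plane R) (S : 'I_m -> plane R -> plane R) : Prop := {
  cps_similarity : forall i, contracting_similarity (S i);
  cps_sub : forall i, S i @` polygon A `<=` polygon A;
  cps_meet : forall i j, i != j ->
    S i @` polygon A `&` S j @` polygon A = set0 \/
    exists k l, S i (A k) = S j (A l) /\
      S i @` polygon A `&` S j @` polygon A = [set S i (A k)];
  cps_vertex : forall k, exists i l, S i (A l) = A k;
  cps_contractible : contractible (\bigcup_i (S i @` polygon A)) }.

Definition symmetric_system (R : realType) (m : nat)
    (G : set (plane R -> plane R)) (S : 'I_m -> plane R -> plane R) :=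
  forall g i, G g -> exists g' j, G g' /\ g \o S i = S j \o g'.

Definition attractor (R : realType) (m : nat)
    (S : 'I_m -> plane R -> plane R) (K : set (plane R)) :=
  [/\ K !=set0, compact K & K = \bigcup_i (S i @` K)].

Definition jordan_arc (R : realType) (x y : plane R) (c : set (plane R)) :=
  exists f : R -> plane R,
    [/\ {within `[0, 1], continuous f}, {in `[0, 1] &, injective f},
        f 0 = x, f 1 = y & c = f @` `[0, 1]].

(* For the attractor K of a contractible polygonal system, a dendrite, there is
   exactly one such family of arcs (and arc i j = arc j i). *)
Definition arcs_between_vertices (R : realType) (n : nat)
    (A : 'I_n -> plane R) (K : set (plane R))
    (arc : 'I_n -> 'I_n -> set (plane R)) :=
  forall i j, i != j -> jordan_arc (A i) (A j) (arc i j) /\ arc i j `<=` K.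

Definition main_tree (R : realType) (n : nat)
    (arc : 'I_n -> 'I_n -> set (plane R)) : set (plane R) :=
  \bigcup_(ij in [set ij : 'I_n * 'I_n | ij.1 != ij.2]) arc ij.1 ij.2.

(* The order of p in X is the cardinality of this set. *)
Definition branches (T : topologicalType) (p : T) (X : set T) : set (set T) :=
  [set connected_component (X `\ p) x | x in X `\ p].

Definition ramification_point (T : topologicalType) (X : set T) (p : T) :=
  X p /\ (`I_3 #<= branches p X)%card.

(* Main.v *)
Require Import Defs.
From mathcomp Require Import all_boot all_order all_algebra.
From mathcomp Require Import all_classical all_reals all_analysis.
From mathcomp Require Import ring lra.

Import Order.TTheory GRing.Theory Num.Theory.
Import numFieldNormedType.Exports.
Local Open Scope classical_set_scope.
Local Open Scope ring_scope.

Set Implicit Arguments.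
Unset Strict Implicit.
Unset Printing Implicit Defensive.

(* Call a set X liftable when every continuous map from X to the circle is
   the exponential of a continuous angle. The union of the first-level polygons
   is contractible, hence liftable. A circle map on a compact subset of the
   attractor K has an angle on every sufficiently small piece, and the angles
   of the pieces of one level glue, level by level: extend them by Tietze's
   theorem to the whole (contractible) union of polygons and lift there. So all
   compact subsets of K are liftable; consequently two subcontinua of K have a
   connected intersection, and an arc of K lies in every subcontinuum of K that
   contains its end points.
   In particular the main tree is a continuum mapped into itself by the rotation
   g. It contains O: otherwise the direction of x - O would lift to an angle th
   with th (g x) - th x constant, which contradicts g^n = id. Let b be an arc
   of the tree from O to a vertex. If b and g^k b met outside O, then g^k would
   stabilise an initial piece of b and, having finite order, fix its end point.
   So the main tree is the union of n arcs g^k b that only share O. *)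

Local Notation edist := Defs.edist.
Local Notation point := Defs.point.

(** * Continuous angles *)

Lemma within_continuousP (T U : topologicalType) (A : set T) (f : T -> U) :
  {within A, continuous f} <-> forall x, A x -> f @ within A (nbhs x) --> f x.
Proof. exact: subspace_continuousP. Qed.

Lemma within_continuous_comp (T U V : topologicalType) (A : set T) (B : set U)
    (f : T -> U) (g : U -> V) :
  {within A, continuous f} -> {within B, continuous g} ->
  (forall x, A x -> B (f x)) -> {within A, continuous (g \o f)}.
Proof.
move=> /within_continuousP cf /within_continuousP cg AB.
apply/within_continuousP => x Ax.
move=> W /(cg _ (AB _ Ax)) WB.
have := cf _ Ax _ WB; rewrite /nbhs /= /within /= => H.
by apply: filterS H => y /= h Ay; exact/h/AB.
Qed.

Lemma unit_angle (R : realType) (c s : R) :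
  c ^+ 2 + s ^+ 2 = 1 -> exists t, c = cos t /\ s = sin t.
Proof.
move=> cs1.
have c1 : -1 <= c <= 1 by apply/andP; split; nra.
have [s0|s0] := leP 0 s.
  exists (acos c); rewrite acosK ?in_itv//= sin_acos//; split => //.
  by rewrite -(ger0_norm s0) -sqrtr_sqr; congr Num.sqrt; lra.
exists (- acos c); rewrite cosN sinN acosK ?in_itv//= sin_acos//; split => //.
rewrite (_ : 1 - c ^+ 2 = s ^+ 2); last lra.
by rewrite sqrtr_sqr ltr0_norm// opprK.
Qed.

(* [(c, s)] is a continuous map from [A] to the unit circle. *)
Definition unit_pair (R : realType) (T : topologicalType) (A : set T)
    (c s : T -> R) :=
  [/\ {within A, continuous c}, {within A, continuous s} &
      forall x, A x -> c x ^+ 2 + s x ^+ 2 = 1].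

Definition angle_lift (R : realType) (T : topologicalType) (A : set T)
    (c s : T -> R) :=
  exists2 th : T -> R, {within A, continuous th} &
    forall x, A x -> c x = cos (th x) /\ s x = sin (th x).

(** A positive inner product keeps the quotient of the two circle maps in the open right half plane.
    There its angle is [asin] of its sine [q], which is a continuous correction to the given
    angle. *)
Lemma lift_close (R : realType) (T : topologicalType) (A : set T)
    (c s c0 s0 : T -> R) :
  unit_pair A c s -> unit_pair A c0 s0 -> angle_lift A c0 s0 ->
  (forall x, A x -> 0 < c x * c0 x + s x * s0 x) -> angle_lift A c s.
Proof.
move=> [/within_continuousP cc /within_continuousP cs cs1].
move=> [/within_continuousP cc0 /within_continuousP cs0 cs01].
move=> [th /within_continuousP cth thE] pos.
pose q x := s x * c0 x - c x * s0 x.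
have pq x : A x -> (c x * c0 x + s x * s0 x) ^+ 2 + q x ^+ 2 = 1.
  move=> Ax; rewrite /q -[RHS]mulr1 -{1}(cs1 x)// -(cs01 x)//; ring.
have q1 x : A x -> -1 < q x < 1.
  by move=> Ax; have := pos _ Ax; have := pq _ Ax => ? ?; apply/andP; split; nra.
exists (fun x => th x + asin (q x)); last first.
  move=> x Ax; have /andP[q1l q1r] := q1 _ Ax.
  have qI : -1 <= q x <= 1 by rewrite !ltW.
  have ce : cos (asin (q x)) = c x * c0 x + s x * s0 x.
    rewrite cos_asin// -(pq _ Ax) addrK sqrtr_sqr gtr0_norm//; exact: pos.
  have se : sin (asin (q x)) = q x by rewrite asinK// in_itv.
  have [E1 E2] := thE _ Ax; rewrite cosD sinD ce se -E1 -E2 /q.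
  split; have := cs01 _ Ax => h.
    rewrite -[LHS]mulr1 -h; ring.
  rewrite -[LHS]mulr1 -h; ring.
apply/within_continuousP => x Ax; apply: cvgD; first exact: cth.
apply: (@cvg_comp _ _ _ q (@asin R) _ (nbhs (q x))); last exact/continuous_asin/q1.
by apply: cvgB; apply: cvgM; [exact: cs|exact: cc0|exact: cc|exact: cs0].
Qed.

Lemma lift_cst (R : realType) (T : topologicalType) (A : set T) (c s : R) :
  c ^+ 2 + s ^+ 2 = 1 -> angle_lift A (fun=> c) (fun=> s).
Proof.
move=> /unit_angle[t [-> ->]]; exists (fun=> t) => //.
by apply/within_continuousP => x _; exact: cvg_cst.
Qed.

Lemma lift_ext (R : realType) (T : topologicalType) (A : set T)
    (c s c' s' : T -> R) :
  (forall x, A x -> c x = c' x /\ s x = s' x) ->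
  angle_lift A c s -> angle_lift A c' s'.
Proof.
move=> E [th cth thE]; exists th => // x Ax; have [<- <-] := E _ Ax; exact: thE.
Qed.

Lemma liftW (R : realType) (T : topologicalType) (A B : set T) (c s : T -> R) :
  A `<=` B -> angle_lift B c s -> angle_lift A c s.
Proof.
move=> AB [th cth thE]; exists th; first exact: continuous_subspaceW cth.
by move=> x /AB; exact: thE.
Qed.

(** A Lebesgue number argument: locally both coordinates vary by less than 1/4, and compactness
    makes the scale uniform. *)
Lemma unit_pair_uniform (R : realType) (T : pseudoMetricType R) (A : set T)
    (c s : T -> R) :
  compact A -> unit_pair A c s -> exists2 e : R, 0 < e &
    forall x y, A x -> A y -> ball x e y -> 0 < c x * c y + s x * s y.
Proof.
move=> cA [/within_continuousP cc /within_continuousP cs cs1].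
have /near_covering_withinP covA := (compact_near_coveringP A).1 cA.
have H : \forall e \near (0:R)^'+, A `<=` [set x | forall y, A y -> ball x e y ->
    0 < c x * c y + s x * s y].
  apply: covA => x Ax.
  have /cvgrPdist_lt/(_ (1/4)) h1 := cc _ Ax.
  have /cvgrPdist_lt/(_ (1/4)) h2 := cs _ Ax.
  have [e /= e0 eP] : exists2 e : R, 0 < e & forall y, ball x e y -> A y ->
      `|c x - c y| < 1/4 /\ `|s x - s y| < 1/4.
    have /nbhs_ballP[e1 e10 B1] := h1 ltac:(lra).
    have /nbhs_ballP[e2 e20 B2] := h2 ltac:(lra).
    exists (Num.min e1 e2); first by rewrite lt_min e10.
    move=> y xy Ay; split; [apply: B1|apply: B2] => //.
      by apply: le_ball xy; rewrite ge_min lexx.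
    by apply: le_ball xy; rewrite ge_min lexx orbT.
  (* With half the radius, [x'] and any [y] within [d] of it both stay in the ball of radius [e]
     about [x]. *)
  exists (ball x (e/2), [set d : R | d <= e/2]).
    split; first by apply: nbhsx_ballx; lra.
    by apply: nbhs_right_le; lra.
  move=> [x' d] /= [xx' de] Ax' y Ay x'y.
  have [||C1 S1] := eP x' => //; first by apply: le_ball xx'; lra.
  have [||C2 S2] := eP y => //.
    rewrite (splitr e); apply: ball_triangle xx' _.
    by apply: le_ball x'y.
  move: (cs1 _ Ax) C1 S1 C2 S2; rewrite !ltr_norml.
  move=> E /andP[? ?] /andP[? ?] /andP[? ?] /andP[? ?].
  set a := c x in E *; set b := s x in E *.
  (* The squared chord is 2 minus twice the inner product; being below 1/2, it forces the inner
     product to be positive. *)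
  have : (c x' - c y) ^+ 2 < 1/4 by nra.
  have : (s x' - s y) ^+ 2 < 1/4 by nra.
  move: (cs1 _ Ax') (cs1 _ Ay); nra.
have [e [e0 He]] : exists e : R, 0 < e /\
    A `<=` [set x | forall y, A y -> ball x e y -> 0 < c x * c y + s x * s y].
  near (0:R)^'+ => e; exists e; split; first by near: e; exact: nbhs_right_gt.
  by near: e.
by exists e => // x y Ax Ay; apply: He.
Unshelve. all: by end_near. Qed.

(** Any single value of the map serves as the constant reference map in [lift_close]. *)
Lemma lift_small (R : realType) (T : pseudoMetricType R) (A : set T)
    (c s : T -> R) :
  unit_pair A c s -> (forall x y, A x -> A y -> 0 < c x * c y + s x * s y) ->
  angle_lift A c s.
Proof.
move=> csA pos; have [[x0 Ax0]|/nonemptyPn->] := pselect (A !=set0); last first.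
  by exists (fun=> 0) => //; exact: continuous_subspace0.
have cs1 := let: And3 _ _ h := csA in h x0 Ax0.
apply: (lift_close csA _ (@lift_cst _ _ A _ _ cs1)) => [|x Ax]; last exact: pos.
by split => //; apply/within_continuousP => x _; exact: cvg_cst.
Qed.

(** For compact sets this is the vanishing of the first integral Čech cohomology group. *)
Definition liftable (R : realType) (T : topologicalType) (A : set T) :=
  forall c s : T -> R, unit_pair A c s -> angle_lift A c s.

Lemma unit_pair_comp (R : realType) (T U : topologicalType) (A : set T)
    (B : set U) (f : T -> U) (c s : U -> R) :
  {within A, continuous f} -> (forall x, A x -> B (f x)) ->
  unit_pair B c s -> unit_pair A (c \o f) (s \o f).
Proof.
move=> cf AB [cc cs cs1]; split; try exact: within_continuous_comp cf _ AB.
by move=> x /AB; exact: cs1.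
Qed.

Lemma lift_comp (R : realType) (T U : topologicalType) (A : set T)
    (B : set U) (f : T -> U) (c s : U -> R) :
  {within A, continuous f} -> (forall x, A x -> B (f x)) ->
  angle_lift B c s -> angle_lift A (c \o f) (s \o f).
Proof.
move=> cf AB [th cth thE]; exists (th \o f).
  exact: within_continuous_comp cf cth AB.
by move=> x /AB; exact: thE.
Qed.

(** The end of the contraction is a constant map, which has an angle. The angle is carried back
    along the homotopy in [N] time steps, each short enough for [lift_close]. *)
Lemma contractible_liftable (R : realType) (X : set (plane R)) :
  compact X -> contractible X -> liftable R X.
Proof.
move=> cX [a [H [Xa cH XH H0 H1]]] c s cs.
pose D : set (plane R * R) := X `*` `[0, 1].
have XI : unit_pair D (c \o H) (s \o H).
  by apply: unit_pair_comp cH _ cs => -[x t] [/= Xx tI]; exact: XH.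
have cXI : compact D.
  by apply: compact_setX => //; exact: segment_compact.
have [e e0 He] := unit_pair_uniform cXI XI.
pose N := (Num.truncn e^-1).+1.
have N0 : 0 < N%:R :> R by rewrite ltr0n.
have Ne : N%:R^-1 < e.
  have e'0 : 0 <= e^-1 by rewrite invr_ge0 ltW.
  by rewrite invf_plt ?posrE//; have /andP[] := truncn_itv e'0.
(* Time runs backwards, from the constant map at [j = 0] to the identity at [j = N]. *)
pose t j : R := 1 - j%:R / N%:R.
have tI j : (j <= N)%N -> t j \in `[0, 1].
  move=> jN; rewrite in_itv/= /t subr_ge0 ler_pdivrMr// mul1r ler_nat jN/=.
  by rewrite lerBlDr lerDl divr_ge0.
have csH j : (j <= N)%N ->
    unit_pair X (fun x => c (H (x, t j))) (fun x => s (H (x, t j))).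
  move=> jN; have cp : continuous (fun x : plane R => (x, t j)).
    move=> x W [[U V] /= [Ux Vt] UV]; apply: filterS Ux => y Uy.
    by apply: UV; split => //=; exact: nbhs_singleton.
  have := unit_pair_comp (continuous_subspaceT cp) _ XI; apply.
  by move=> x Xx; split => //=; exact: tI.
have main j : (j <= N)%N ->
    angle_lift X (fun x => c (H (x, t j))) (fun x => s (H (x, t j))).
  elim: j => [_|j IH jN].
    have /lift_cst : c a ^+ 2 + s a ^+ 2 = 1 by case: cs => _ _; apply.
    by move=> /(_ _ X); apply: lift_ext => x Xx; rewrite /t mul0r subr0 H1.
  apply: (lift_close (csH _ jN) (csH _ (ltnW jN)) (IH (ltnW jN))) => x Xx.
  apply: (He (x, t j.+1) (x, t j)); try by split => //=; apply: tI => //; exact: ltnW.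
  split => /=; first exact: ballxx.
  rewrite /ball/= /t -natr1 (_ : _ - _ = - N%:R^-1); last by field; rewrite gt_eqF.
  by rewrite normrN gtr0_norm// invr_gt0.
apply: lift_ext (main N (leqnn N)) => x Xx.
by rewrite /t divff ?gt_eqF// subrr H0.
Qed.

(** * Gluing angles over finitely many closed pieces *)

Lemma eq_within_continuous (T U : topologicalType) (A : set T) (f g : T -> U) :
  (forall x, A x -> f x = g x) ->
  {within A, continuous f} -> {within A, continuous g}.
Proof.
by move=> fg; apply: subspace_eq_continuous => x /set_mem Ax; exact: fg.
Qed.

Lemma finite_closed (T : topologicalType) (A : set T) :
  hausdorff_space T -> finite_set A -> closed A.
Proof.
move=> /hausdorff_accessible hT; exact: (accessible_finite_set_closed.1 hT).
Qed.

(** Every subset of a finite set is closed in a Hausdorff space, so the subspace is discrete. *)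
Lemma within_finite_continuous (T U : topologicalType) (A : set T)
    (f : T -> U) :
  hausdorff_space T -> finite_set A -> {within A, continuous f}.
Proof.
move=> hT fA; apply/continuous_closedP => W _; apply/closed_subspaceP.
exists (f @^-1` W `&` A); last by rewrite -setIA setIid.
by apply: finite_closed => //; apply: sub_finite_set fA => x [].
Qed.

Lemma within_bigcup_continuous (T U : topologicalType) (m : nat)
    (P : 'I_m -> set T) (f : T -> U) :
  (forall i, closed (P i)) -> (forall i, {within P i, continuous f}) ->
  {within \bigcup_i P i, continuous f}.
Proof.
move=> cP cf; apply/continuous_closedP => W cW; apply/closed_subspaceP.
have /choice[V VP] : forall i, exists V, closed V /\
    V `&` P i = f @^-1` W `&` P i.
  move=> i; have /continuous_closedP/(_ _ cW)/closed_subspaceP[V ? ?] := cf i.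
  by exists V.
exists (\bigcup_i (V i `&` P i)).
  apply: closed_bigcup => [|i _]; first exact: finite_finset.
  by apply: closedI => //; have [] := VP i.
apply/seteqP; split=> x [].
  move=> [i _]; have [_ ->] := VP i => -[Wx Px] _; split=> //; by exists i.
move=> Wx [i _ Px]; split; last by exists i.
by exists i => //; have [_ ->] := VP i.
Qed.

Lemma continuous_extension (R : realType) (T : pseudoMetricType R)
    (A : set T) (f : T -> R) :
  hausdorff_space T -> compact A -> {within A, continuous f} ->
  exists2 g : T -> R, continuous g & forall x, A x -> f x = g x.
Proof.
move=> hT cA cf.
have [M [Mr HM]] := compact_bounded (continuous_compact cf cA).
(* The bounded form of Tietze's theorem gets a positive bound, and [HM] only speaks of bounds
   strictly above [M]. *)
have M0 : 0 < Num.max (M + 1) 1 by rewrite lt_max ltr01 orbT.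
have [||g [fg cg _]] := @continuous_bounded_extension T R
  pseudometric_normal A (compact_closed hT cA) f _ M0.
- exact: cf.
- move=> x Ax; apply: (HM (Num.max (M + 1) 1)); last by exists x.
  by rewrite lt_max ltrDl ltr01.
- by exists g => // x Ax; apply: fg; exact: mem_set.
Qed.

(* The points of F outside A are given the value (1, 0) and the angle 0, so that
   the Tietze extensions of the angles agree on the overlaps of the P i. *)
Lemma lift_glue (R : realType) (T : pseudoMetricType R) (m : nat)
    (P : 'I_m -> set T) (F A : set T) (c s : T -> R) :
  hausdorff_space T -> (forall i, closed (P i)) -> finite_set F ->
  (forall i j, i != j -> P i `&` P j `<=` F) -> liftable R (\bigcup_i P i) ->
  compact A -> A `<=` \bigcup_i P i -> unit_pair A c s ->
  (forall i, angle_lift (A `&` P i) c s) -> angle_lift A c s.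
Proof.
move=> hT cP fF PF lP cA AP cs lA.
have clA := compact_closed hT cA.
have clF := finite_closed hT fF.
have cF : compact F by exact: finite_compact.
pose A' := A `|` F.
have cA' : compact A' by exact: compactU.
pose c' x := if x \in A then c x else 1.
pose s' x := if x \in A then s x else 0.
have cs'E x : A x -> c' x = c x /\ s' x = s x.
  by move=> Ax; rewrite /c' /s' mem_set.
have fFA i : finite_set ((F `\` A) `&` P i).
  by apply: sub_finite_set fF => x [[]].
have /choice[g gP] : forall i, exists g : T -> R, continuous g /\
    forall x, A' x -> P i x -> c' x = cos (g x) /\ s' x = sin (g x).
  move=> i; have [th cth thE] := lA i.
  pose th' x := if x \in A then th x else 0.
  have cth' : {within (A `&` P i) `|` ((F `\` A) `&` P i), continuous th'}.
    apply: withinU_continuous.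
    - exact: closedI.
    - exact: finite_closed.
    - apply: (@eq_within_continuous _ _ _ th) => [x [Ax _]|]; last exact: cth.
      by rewrite /th' mem_set.
    - exact: within_finite_continuous.
  have E : (A `&` P i) `|` ((F `\` A) `&` P i) = A' `&` P i.
    rewrite /A'; apply/seteqP; split=> x.
      by move=> [[Ax Px]|[[Fx _] Px]]; split => //; [left|right].
    by move=> [[Ax|Fx] Px]; have [Ax'|nAx] := pselect (A x); by [left|right].
  rewrite E in cth'.
  have [|g cg gE] := continuous_extension hT _ cth'.
    exact: compact_closedI.
  exists g; split=> // x Ax Px; rewrite -gE// /th' /c' /s'.
  case: ifPn => [/set_mem Ax'|_]; last by rewrite cos0 sin0.
  exact: thE.
(* Outside [A'] at most one [P i] contains the point, because overlaps lie in [F]; so [pick] makes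
   no real choice. On [A'] the extensions agree with the prescribed values. *)
pose sel (k k' : R -> R) (k0 : T -> R) x := if x \in A' then k0 x else
  if [pick i | x \in P i] is Some i then k (g i x) else 0.
pose ct := sel cos cos c'; pose st := sel sin sin s'.
have ctE i x : P i x -> ct x = cos (g i x) /\ st x = sin (g i x).
  move=> Px; rewrite /ct /st /sel; case: ifPn => [/set_mem Ax|nAx].
    by have [_ /(_ _ Ax Px)] := gP i.
  case: pickP => [j /set_mem Pj|/(_ i)]; last by rewrite mem_set.
  suff -> : j = i by [].
  apply/eqP/negPn/negP => ji; move: nAx; rewrite notin_setE; apply; right.
  exact: (PF j i).
have cst : unit_pair (\bigcup_i P i) ct st.
  split; last by move=> x [i _ Px]; have [-> ->] := ctE _ _ Px; exact: cos2Dsin2.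
    apply: within_bigcup_continuous => // i.
    apply: (@eq_within_continuous _ _ _ (cos \o g i)).
      by move=> x Px; have [->] := ctE _ _ Px.
    apply: continuous_subspaceT => x.
    apply: continuous_comp; last exact: continuous_cos.
    by have [+ _] := gP i; apply.
  apply: within_bigcup_continuous => // i.
  apply: (@eq_within_continuous _ _ _ (sin \o g i)).
    by move=> x Px; have [_ ->] := ctE _ _ Px.
  apply: continuous_subspaceT => x.
  apply: continuous_comp; last exact: continuous_sin.
  by have [+ _] := gP i; apply.
apply: lift_ext (liftW AP (lP _ _ cst)) => x Ax.
have A'x : A' x by left.
by rewrite /ct /st /sel mem_set//; exact: cs'E.
Qed.

(** * Uniqueness of angles and unicoherence *)

Lemma cos1_cst (R : realType) (T : topologicalType) (A : set T) (f : T -> R) :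
  connected A -> {within A, continuous f} -> (forall x, A x -> cos (f x) = 1) ->
  forall x y, A x -> A y -> f x = f y.
Proof.
move=> conA cf f1.
suff H x y : A x -> A y -> ~ (f x < f y).
  move=> x y Ax Ay; apply/eqP; rewrite eq_le !leNgt.
  by apply/andP; split; apply/negP; exact: H.
move=> Ax Ay fxy.
have /connected_intervalP int := connected_continuous_connected conA cf.
(* An intermediate value at most 1 above [f x]: the difference is positive and less than [pi], where
   the cosine is injective and cannot return to 1. *)
pose v := Num.min (f y) (f x + 1).
have [z Az zE] : (f @` A) v.
  apply: (int (f x) (f y)); [by exists x|by exists y|].
  rewrite /v ge_min lexx /= le_min (ltW fxy) lerDl ler01//.
have [d0 d1] : 0 < f z - f x /\ f z - f x <= 1.
  rewrite zE /v subr_gt0 lt_min fxy ltrDl ltr01; split=> //.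
  by rewrite lerBlDl ge_min lexx orbT.
have s0 x' : A x' -> sin (f x') = 0.
  by move=> /f1 h; apply: cos1sin0; rewrite h normr1.
have : cos (f z - f x) = cos 0.
  by rewrite cosB !f1// !s0// mulr0 addr0 mulr1 cos0.
have := pi_ge2 R => pi2.
move=> /cos_inj; rewrite !in_itv/=.
have -> : 0 <= f z - f x <= pi by apply/andP; split; lra.
have -> : 0 <= (0 : R) <= pi by apply/andP; split; lra.
by move=> /(_ isT isT) ?; lra.
Qed.

(** Pointwise the two angles differ by a multiple of a full turn, and these multiples are
    discrete. *)
Lemma lift_diff_cst (R : realType) (T : topologicalType) (A : set T)
    (f g : T -> R) :
  connected A -> {within A, continuous f} -> {within A, continuous g} ->
  (forall x, A x -> cos (f x) = cos (g x) /\ sin (f x) = sin (g x)) ->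
  forall x y, A x -> A y -> f x - g x = f y - g y.
Proof.
move=> conA cf cg E x y Ax Ay.
apply: (cos1_cst (f := fun x => f x - g x) conA _ _ Ax Ay) => [|z Az].
  move: cf cg => /within_continuousP cf /within_continuousP cg.
  apply/within_continuousP => z Az; apply: cvgB; [exact: cf|exact: cg].
by have [h1 h2] := E z Az; rewrite cosB h1 h2 -!expr2 cos2Dsin2.
Qed.

(* If A `&` B split into E0 and E1, the circle map that winds once around along A
   while going from E0 to E1, and is constant on B, would have no angle. *)
Lemma unicoherence (R : realType) (T : pseudoMetricType R) (A B : set T) :
  hausdorff_space T -> compact A -> compact B -> connected A -> connected B ->
  liftable R (A `|` B) -> connected (A `&` B).
Proof.
move=> hT cA cB conA conB lAB; apply: contrapT => /connectedPn[E [E0 ABE sE]].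
have clA := compact_closed hT cA; have clB := compact_closed hT cB.
(* A limit point of one half lies in the closed intersection, and separation keeps it out of the
   other half. *)
have clE b : closed (E b).
  move=> x Ex.
  have : (A `&` B) x.
    apply: (closedI clA clB); move: x Ex; apply: closureS.
    by rewrite ABE; case: b; [right|left].
  rewrite ABE; case: sE => s1 s2; case: b Ex => Ex [] // Ex'.
    by exfalso; rewrite -[False]/(set0 x) -s2.
  by exfalso; rewrite -[False]/(set0 x) -s1.
have [u [cu u0 u1 _]] := urysohn_ext_itv pseudometric_normal (clE false)
  (clE true) (separated_disjoint sE) (@ltr01 R).
pose w x := pi *+ 2 * u x.
have cw : continuous w by move=> x; apply: cvgM; [exact: cvg_cst|exact: cu].
have wE x : A x -> B x -> cos (w x) = 1 /\ sin (w x) = 0.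
  move=> Ax Bx; have : (A `&` B) x by [].
  rewrite /w ABE => -[Ex|Ex].
    have -> : u x = 0 by apply: u0; exists x.
    by rewrite mulr0 cos0 sin0.
  have -> : u x = 1 by apply: u1; exists x.
  by rewrite mulr1 cos2pi sin2pi.
pose c x := if x \in A then cos (w x) else 1.
pose s x := if x \in A then sin (w x) else 0.
have csA x : A x -> c x = cos (w x) /\ s x = sin (w x).
  by move=> Ax; rewrite /c /s mem_set.
have csB x : B x -> c x = 1 /\ s x = 0.
  move=> Bx; rewrite /c /s; case: ifPn => [/set_mem Ax|//]; exact: wE.
have cst : unit_pair (A `|` B) c s.
  split.
  - apply: withinU_continuous => //.
      apply: (@eq_within_continuous _ _ _ (cos \o w)).
        by move=> x Ax; have [->] := csA _ Ax.
      by apply: continuous_subspaceT => x; apply: continuous_comp;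
        [exact: cw|exact: continuous_cos].
    apply: (@eq_within_continuous _ _ _ (fun=> 1 : R)).
      by move=> x Bx; have [->] := csB _ Bx.
    by apply: continuous_subspaceT => x; exact: cvg_cst.
  - apply: withinU_continuous => //.
      apply: (@eq_within_continuous _ _ _ (sin \o w)).
        by move=> x Ax; have [_ ->] := csA _ Ax.
      by apply: continuous_subspaceT => x; apply: continuous_comp;
        [exact: cw|exact: continuous_sin].
    apply: (@eq_within_continuous _ _ _ (fun=> 0 : R)).
      by move=> x Bx; have [_ ->] := csB _ Bx.
    by apply: continuous_subspaceT => x; exact: cvg_cst.
  - move=> x [/csA[-> ->]|/csB[-> ->]]; first exact: cos2Dsin2.
    by rewrite expr1n expr0n addr0.
have [th cth thE] := lAB _ _ cst.
have [x Ex] := E0 false; have [y Ey] := E0 true.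
have [Ax Bx] : (A `&` B) x by rewrite ABE; left.
have [Ay By] : (A `&` B) y by rewrite ABE; right.
(* Along [A] the angle follows [w], which gains a full turn from [x] to [y]; along [B] it is
   constant. The two are incompatible. *)
have H1 : th x - w x = th y - w y.
  apply: (@lift_diff_cst _ _ A) => //.
  - by apply: continuous_subspaceW cth; left.
  - exact: continuous_subspaceT.
  - by move=> z Az; have [<- <-] := csA _ Az; have [<- <-] := thE z (or_introl Az).
have H2 : th x = th y.
  apply: (@cos1_cst _ _ B) => //.
  - by apply: continuous_subspaceW cth; right.
  - by move=> z Bz; have [<- _] := thE z (or_intror Bz); have [] := csB _ Bz.
move: H1; rewrite H2 /w.
have -> : u x = 0 by apply: u0; exists x.
have -> : u y = 1 by apply: u1; exists y.
have := pi_gt0 R; lra.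
Qed.

(** * Similarities and attractors *)

Lemma edistE (R : realType) (x y : plane R) :
  edist x y = Num.sqrt ((x 0 0 - y 0 0) ^+ 2 + (x 0 1 - y 0 1) ^+ 2).
Proof.
rewrite /edist 2!big_ord_recl big_ord0 addr0.
by rewrite (_ : lift ord0 ord0 = 1)//; apply/val_inj.
Qed.

Lemma edist_ge0 (R : realType) (x y : plane R) : 0 <= edist x y.
Proof. exact: sqrtr_ge0. Qed.

(** Together with [edist_le_norm], this transfers Euclidean estimates to the topology defined by the
    sup norm. *)
Lemma norm_le_edist (R : realType) (x y : plane R) : `|x - y| <= edist x y.
Proof.
rewrite [leLHS]/Num.norm/= mx_normrE; apply/bigmax_leP; split=> [|[i j] _ /=].
  exact: edist_ge0.
rewrite (ord1 i) mxE [(- y) _ _]mxE edistE -sqrtr_sqr; apply: ler_wsqrtr.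
have [->|->] : j = 0 \/ j = 1.
  by case: j => [[|[|//]] ?]; [left|right]; exact/val_inj.
  by rewrite lerDl sqr_ge0.
by rewrite lerDr sqr_ge0.
Qed.

Lemma coord_le_norm (R : realType) (x : plane R) i : `|x 0 i| <= `|x|.
Proof.
rewrite [leRHS]/Num.norm/= mx_normrE; apply/bigmax_geP; right.
by exists (0, i).
Qed.

Lemma edist_le_norm (R : realType) (x y : plane R) : edist x y <= 2 * `|x - y|.
Proof.
have n0 := normr_ge0 (x - y).
rewrite edistE -(ger0_norm (mulr_ge0 (ler0n R 2) n0)) -sqrtr_sqr.
apply: ler_wsqrtr.
have h (i : 'I_2) : (x 0 i - y 0 i) ^+ 2 <= `|x - y| ^+ 2.
  have := coord_le_norm (x - y) i; rewrite !mxE => h.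
  by rewrite -real_normK ?num_real// lerXn2r ?nnegrE.
by have := h 0; have := h 1; nra.
Qed.

Lemma edist_eq0 (R : realType) (x y : plane R) : edist x y = 0 -> x = y.
Proof.
move=> d0; apply/eqP; rewrite -subr_eq0 -normr_eq0 eq_le normr_ge0 andbT.
by rewrite -d0 norm_le_edist.
Qed.

Lemma edist_lipschitz_continuous (R : realType) (A : set (plane R))
    (f : plane R -> plane R) (r : R) :
  (forall x y, A x -> A y -> edist (f x) (f y) <= r * edist x y) ->
  {within A, continuous f}.
Proof.
move=> fr; apply/within_continuousP => x Ax; apply/cvgrPdist_lt => e e0.
pose M := Num.max r 1; have M0 : 0 < M by rewrite lt_max ltr01 orbT.
have d0 : 0 < e / (2 * M) by rewrite divr_gt0// mulr_gt0.
apply/nbhs_ballP; exists (e / (2 * M)) => //= y xy Ay.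
apply: le_lt_trans (norm_le_edist _ _) _; apply: le_lt_trans (fr _ _ Ax Ay) _.
apply: le_lt_trans (ler_wpM2r (edist_ge0 _ _) (_ : r <= M)) _.
  by rewrite le_max lexx.
apply: le_lt_trans (ler_wpM2l (ltW M0) (edist_le_norm _ _)) _.
by move: xy; rewrite -ball_normE/= ltr_pdivlMr ?mulr_gt0//; lra.
Qed.

Lemma similarity_continuous (R : realType) (A : set (plane R))
    (f : plane R -> plane R) :
  contracting_similarity f -> {within A, continuous f}.
Proof.
move=> [r [r0 r1 fr]]; apply: (@edist_lipschitz_continuous _ _ _ r) => x y _ _.
by rewrite fr.
Qed.

(** The polygon is the continuous image of the simplex of weights, a closed slice of the unit
    cube. *)
Lemma polygon_compact (R : realType) (n : nat) (A : 'I_n -> plane R) :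
  compact (polygon A).
Proof.
pose W : set 'rV[R]_n := [set w | forall i, w 0 i \in `[0, 1]].
have cW : compact W.
  by apply: (@rV_compact R n (fun=> `[0, 1]%classic)) => i; exact: segment_compact.
pose q (w : 'rV[R]_n) : R := \sum_k w 0 k.
have cq : continuous q.
  rewrite (_ : q = \sum_k (fun w : 'rV[R]_n => w 0 k)); last first.
    by apply/funext => w; rewrite fct_sumE.
  elim/big_ind : _ => [x|f g cf cg x|k _].
  - exact: cst_continuous.
  - exact: (cvgD (cf x) (cg x)).
  - exact: coord_continuous.
pose h (w : 'rV[R]_n) : plane R := \sum_k w 0 k *: A k.
have ch : continuous h.
  rewrite (_ : h = \sum_k (fun w : 'rV[R]_n => w 0 k *: A k)); last first.
    by apply/funext => w; rewrite fct_sumE.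
  elim/big_ind : _ => [x|f g cf cg x|k _ x].
  - exact: cst_continuous.
  - exact: (cvgD (cf x) (cg x)).
  - by have ck := @coord_continuous R 1 n 0 k x; exact: (cvgZr_tmp (a := A k) ck).
suff -> : polygon A = h @` (W `&` q @^-1` [set 1]).
  apply: continuous_compact; first exact: continuous_subspaceT.
  apply: compact_closedI => //; apply: preimage_closed; last exact: closed_eq.
  by move=> x _; exact: cq.
apply/seteqP; split=> x.
  move=> [w [w0 w1 ->]]; exists (\row_k w k).
    split=> [i|]; last by rewrite /q/= -w1; apply: eq_bigr => k _; rewrite mxE.
    rewrite mxE in_itv/= w0/= -w1 (bigD1 i)//= lerDl.
    by apply: sumr_ge0 => k _.
  by apply: eq_bigr => k _; rewrite mxE.
move=> [w [W0 q1] <-]; exists (fun k => w 0 k); split=> // k.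
by have := W0 k; rewrite in_itv/= => /andP[].
Qed.

Lemma expr_small (R : realType) (r D e : R) :
  0 <= r -> r < 1 -> 0 < e -> exists k, r ^+ k * D < e.
Proof.
move=> r0 r1 e0; have /cvg_geometric : `|r| < 1 by rewrite ger0_norm.
move=> /(_ D) /cvgrPdist_lt/(_ _ e0)[k _ /(_ k)] /= h; exists k.
have := h (leqnn k); rewrite sub0r normrN mulrC; exact/le_lt_trans/ler_norm.
Qed.

Lemma contraction_ratio (R : realType) (m : nat) (S : 'I_m -> plane R -> plane R) :
  (forall i, contracting_similarity (S i)) ->
  exists r : R, [/\ 0 <= r, r < 1 &
    forall i x y, edist (S i x) (S i y) <= r * edist x y].
Proof.
move=> cS; have /choice[r rP] : forall i, exists r : R, [/\ 0 < r, r < 1 &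
    forall x y, edist (S i x) (S i y) = r * edist x y] by [].
(* Starting the maximum at 0 also covers an empty system. *)
exists (\big[Num.max/0]_i r i); split.
- exact: bigmax_ge_id.
- by apply/bigmax_ltP; split=> // i _; have [] := rP i.
- move=> i x y; have [_ _ ->] := rP i; apply: ler_wpM2r; first exact: edist_ge0.
  exact: le_bigmax.
Qed.

(** A point of [A] is, for every [k], the image of a point of [A] under a [k]-fold composition of
    maps [S i]. The same composition sends [z0] to a point of [B] at distance at most [r ^+ k * D],
    and [B] is closed. *)
Lemma sub_attracting (R : realType) (m : nat) (S : 'I_m -> plane R -> plane R)
    (A B : set (plane R)) :
  (forall i, contracting_similarity (S i)) -> compact A -> closed B ->
  B !=set0 -> A `<=` \bigcup_i (S i @` A) -> (forall i, S i @` B `<=` B) ->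
  A `<=` B.
Proof.
move=> cS cA clB [z0 Bz0] AS SB; have [r [r0 r1 rS]] := contraction_ratio cS.
have [M [_ HM]] := compact_bounded cA.
pose D := 2 * (M + 1 + `|z0|).
have AD x : A x -> edist x z0 <= D.
  move=> Ax; apply: le_trans (edist_le_norm _ _) _; rewrite /D ler_pM2l//.
  apply: le_trans (ler_normB _ _) _; rewrite lerD2r; apply: HM => //.
  by rewrite ltrDl.
have main k x : A x -> exists2 z, B z & edist x z <= r ^+ k * D.
  elim: k x => [|k IH] x Ax; first by exists z0 => //; rewrite mul1r; exact: AD.
  have [i _ [y Ay <-]] := AS x Ax; have [z Bz yz] := IH y Ay.
  exists (S i z); first by apply: (SB i); exists z.
  by apply: le_trans (rS _ _ _) _; rewrite exprS -mulrA ler_wpM2l.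
move=> x Ax; apply: clB => U /nbhs_ballP[e /= e0 eU].
have [k kD] := expr_small D r0 r1 e0.
have [z Bz xz] := main k x Ax; exists z; split=> //; apply: eU.
rewrite -ball_normE/=; apply: le_lt_trans kD.
exact: le_trans (norm_le_edist _ _) xz.
Qed.

(** A similarity has an inverse on its image that is Lipschitz with constant [r^-1]; composing with
    it carries the angle over. *)
Lemma lift_image (R : realType) (f : plane R -> plane R) (K T : set (plane R))
    (c s : plane R -> R) :
  contracting_similarity f ->
  angle_lift (K `&` f @^-1` T) (c \o f) (s \o f) ->
  angle_lift (T `&` f @` K) c s.
Proof.
move=> [r [r0 r1 fr]] lK.
have /choice[h hP] : forall y, exists x, (f @` K) y -> K x /\ f x = y.
  move=> y; have [[x Kx fx]|nfy] := pselect ((f @` K) y); first by exists x.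
  by exists 0.
have ch : {within T `&` f @` K, continuous h}.
  apply: (@edist_lipschitz_continuous _ _ _ r^-1) => x y [_ /hP[_ hx]] [_ /hP[_ hy]].
  by rewrite -{2}hx -{2}hy fr mulKf// gt_eqF.
apply: lift_ext (lift_comp (f := h) ch _ lK) => x [Tx /hP[Kx fx]] /=.
  by rewrite fx.
by split=> //; rewrite /preimage/= fx.
Qed.

Lemma finite_bigcup_compact (T : topologicalType) (I : finType)
    (F : I -> set T) :
  (forall i, compact (F i)) -> compact (\bigcup_i F i).
Proof.
move=> cF; rewrite (_ : [set: I] = [set` enum I]); last first.
  by apply/seteqP; split=> i //= _; rewrite mem_enum.
by rewrite bigcup_seq; apply: bigsetU_compact => i _; exact: cF.
Qed.

Lemma attractor_liftable (R : realType) (n m : nat) (A : 'I_n -> plane R)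
    (S : 'I_m -> plane R -> plane R) (K : set (plane R)) :
  contractible_polygonal_system A S -> attractor S K -> (forall k, K (A k)) ->
  K `<=` polygon A ->
  forall T, compact T -> T `<=` K -> liftable R T.
Proof.
move=> [cS SP meetP _ ctrP] [K0 cK KS] KA KP.
have hR : hausdorff_space (plane R) by exact: norm_hausdorff.
have clK := compact_closed hR cK.
have cPi i : compact (S i @` polygon A).
  apply: continuous_compact (@polygon_compact _ _ _).
  exact/similarity_continuous/cS.
have clPi i := compact_closed hR (cPi i).
pose F := [set S ik.1 (A ik.2) | ik in [set: 'I_m * 'I_n]].
have fF : finite_set F by apply: finite_image; exact: finite_finset.
have PF i j : i != j -> S i @` polygon A `&` S j @` polygon A `<=` F.
  move=> ij; have [->//|[k [l [_ ->]]]] := meetP i j ij.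
  by move=> _ ->; exists (i, k).
have lP : liftable R (\bigcup_i (S i @` polygon A)).
  apply: contractible_liftable => //.
  exact: finite_bigcup_compact.
(* A point of [K] coming from another piece can enter this polygon only at a common vertex
   [S i (A k)], and [A k] is in [K]. *)
have KPi i : K `&` S i @` polygon A `<=` S i @` K.
  move=> x [Kx Px]; have [j _ Kjx] : (\bigcup_i (S i @` K)) x by rewrite -KS.
  have [<-|ji] := eqVneq j i; first by [].
  have Pjx : (S j @` polygon A) x by case: Kjx => y Ky <-; exists y => //; exact: KP.
  move: ji; rewrite eq_sym => ij; have [E|[k [l [_ E]]]] := meetP i j ij.
    by have : (set0 : set (plane R)) x by rewrite -E.
  have -> : x = S i (A k) by have : [set S i (A k)] x by rewrite -E.
  by exists (A k).
have [r [r0 r1 rS]] := contraction_ratio cS.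
have [M [_ HM]] := compact_bounded cK.
pose D := 2 * (M + 1 + (M + 1)).
have KD x y : K x -> K y -> edist x y <= D.
  move=> Kx Ky; apply: le_trans (edist_le_norm _ _) _; rewrite /D ler_pM2l//.
  by apply: le_trans (ler_normB _ _) _; apply: lerD; apply: HM => //; rewrite ltrDl.
(* Induction on the scale. [D] bounds the diameter of [K], so scale 0 is [lift_small]. Pulling back
   by [S i] turns positivity at scale [k.+1] into positivity at scale [k], and the angles of the
   pieces are glued. *)
have main k (T : set (plane R)) (c s : plane R -> R) :
    compact T -> T `<=` K -> unit_pair T c s ->
    (forall x y, T x -> T y -> edist x y <= r ^+ k * D ->
      0 < c x * c y + s x * s y) -> angle_lift T c s.
  elim: k T c s => [|k IH] T c s cT TK cs pos.
    apply: (lift_small cs) => x y Tx Ty; apply: pos => //.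
    by rewrite mul1r; apply: KD; exact: TK.
  have TS : T `<=` \bigcup_i (S i @` polygon A).
    move=> x /TK; rewrite KS => -[i _ [y Ky <-]]; exists i => //.
    by exists y => //; exact: KP.
  apply: (lift_glue hR clPi fF PF lP cT TS cs) => i.
  have cSi := @similarity_continuous _ setT _ (cS i).
  apply: (@liftW _ _ _ (T `&` S i @` K)).
    by move=> x [Tx Px]; split=> //; apply: KPi; split=> //; exact: TK.
  apply: lift_image => //; apply: IH.
  - apply: compact_closedI => //; apply: preimage_closed.
      by move=> x _; have := (continuous_subspace_setT (S i)).2 cSi; apply.
    exact: compact_closed.
  - by move=> x [].
  - apply: unit_pair_comp cs; last by move=> x [].
    exact/similarity_continuous/cS.
  - move=> x y [Kx Tx] [Ky Ty] xy; apply: pos => //.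
    apply: le_trans (rS _ _ _) _; rewrite exprS -mulrA; exact: ler_wpM2l.
move=> T cT TK c s cs; have [e e0 He] := unit_pair_uniform cT cs.
have [k kD] := expr_small D r0 r1 e0.
apply: (main k) => // x y Tx Ty xy; apply: He => //.
rewrite -ball_normE/=; apply: le_lt_trans kD.
exact: le_trans (norm_le_edist _ _) xy.
Qed.

(** By unicoherence the arc meets [C] in a connected set containing both ends; a point of the arc
    missing from [C] would disconnect it. *)
Lemma arc_in_continuum (R : realType) (T : pseudoMetricType R) (f : R -> T)
    (a b : R) (C : set T) :
  hausdorff_space T -> a <= b ->
  {within `[a, b], continuous f} -> {in `[a, b] &, injective f} ->
  compact C -> connected C -> C (f a) -> C (f b) ->
  liftable R (f @` `[a, b] `|` C) -> f @` `[a, b] `<=` C.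
Proof.
move=> hT ab cf inj cC conC Ca Cb lfC _ [t /= tI <-]; apply: contrapT => nCt.
have sub u v : u \in `[a, b] -> v \in `[a, b] -> `[u, v]%classic `<=` `[a, b]%classic.
  rewrite !in_itv/= => /andP[? ?] /andP[? ?] x /=; rewrite !in_itv/=.
  by move=> /andP[? ?]; apply/andP; split; lra.
have cI u v : u \in `[a, b] -> v \in `[a, b] -> compact (f @` `[u, v]).
  move=> uI vI; apply: continuous_compact (@segment_compact _ _ _).
  exact: continuous_subspaceW (sub _ _ uI vI) cf.
have aI : a \in `[a, b] by rewrite in_itv/= lexx.
have bI : b \in `[a, b] by rewrite in_itv/= lexx ab.
have conf : connected (f @` `[a, b]).
  by apply: connected_continuous_connected cf; exact: segment_connected.
have := unicoherence hT (cI _ _ aI bI) cC conf conC lfC.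
set X := f @` `[a, b] `&` C => conX.
move: (tI); rewrite in_itv/= => /andP[at_ tb].
have cl1 := compact_closed hT (cI _ _ aI tI).
have cl2 := compact_closed hT (cI _ _ tI bI).
have disj y : C y -> (f @` `[a, t]) y -> (f @` `[t, b]) y -> False.
  move=> Cy [u uI uy] [v vI vy]; have E : f v = f u by rewrite uy.
  have uv : v = u.
    apply: inj E; [exact: sub tI bI _ vI|exact: sub aI tI _ uI].
  move: uI vI; rewrite uv /= !in_itv/= => /andP[_ ut] /andP[tu _].
  apply: nCt; suff -> : t = u by rewrite uy.
  by apply/eqP; rewrite eq_le tu ut.
have Xfb : X (f b) by split=> //; exists b.
(* The part of [X] up to parameter [t] is closed, and also open: its complement in [X] is the part
   from [t] on, since the two overlap only at [f t], which is not in [C]. *)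
have : X `&` f @` `[a, t] = X.
  apply: conX.
  - exists (f a); split; first by split=> //; exists a.
    by exists a => //=; rewrite in_itv/= lexx.
  - exists (~` (f @` `[t, b])); first exact: closed_openC.
    apply/seteqP; split=> y [Xy Yy]; split=> //.
      by move=> Zy; case: Xy => _ Cy; exact: disj Cy Yy Zy.
    have [[u uI uy] _] := Xy; have [ut|tu] := leP u t.
      exists u => //=; move: uI; rewrite /= !in_itv/= => /andP[-> _]//.
    exfalso; apply: Yy; exists u => //=; move: uI.
    by rewrite /= !in_itv/= (ltW tu) => /andP[_ ->].
  - by exists (f @` `[a, t]).
move=> E; have [_ ?] : (X `&` f @` `[a, t]) (f b) by rewrite E.
apply: (disj (f b)) => //; exists b => //=.
by rewrite in_itv/= lexx tb.
Qed.

(** * Rotations *)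

Lemma plane_eq (R : realType) (x y : plane R) :
  x 0 0 = y 0 0 -> x 0 1 = y 0 1 -> x = y.
Proof.
move=> x0 x1; apply/rowP => j.
have [->|->] // : j = 0 \/ j = 1.
by case: j => [[|[|//]] ?]; [left|right]; exact/val_inj.
Qed.

Lemma rotation0 (R : realType) (O x : plane R) t :
  rotation O t x 0 0 =
  O 0 0 + (cos t * (x 0 0 - O 0 0) - sin t * (x 0 1 - O 0 1)).
Proof. by rewrite /rotation /point !mxE. Qed.

Lemma rotation1 (R : realType) (O x : plane R) t :
  rotation O t x 0 1 =
  O 0 1 + (sin t * (x 0 0 - O 0 0) + cos t * (x 0 1 - O 0 1)).
Proof. by rewrite /rotation /point !mxE. Qed.

Lemma rotation_isometry (R : realType) (O : plane R) t x y :
  edist (rotation O t x) (rotation O t y) = edist x y.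
Proof.
rewrite !edistE !rotation0 !rotation1; congr Num.sqrt.
rewrite -[RHS]mul1r -(cos2Dsin2 t); ring.
Qed.

Lemma rotation_continuous (R : realType) (O : plane R) t :
  continuous (rotation O t).
Proof.
apply/continuous_subspace_setT; apply: (@edist_lipschitz_continuous _ _ _ 1).
by move=> x y _ _; rewrite rotation_isometry mul1r.
Qed.

Lemma rotation_inj (R : realType) (O : plane R) t : injective (rotation O t).
Proof.
move=> x y E; apply: edist_eq0; rewrite -(rotation_isometry O t) E edistE.
by rewrite !subrr expr0n addr0 sqrtr0.
Qed.

Lemma rotation_center (R : realType) (O : plane R) t : rotation O t O = O.
Proof.
by apply: plane_eq; rewrite ?rotation0 ?rotation1 !subrr !mulr0 ?subr0 ?addr0.
Qed.

Lemma iter_rotation (R : realType) (O : plane R) t k x :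
  iter k (rotation O t) x = rotation O (k%:R * t) x.
Proof.
elim: k => [|k IH] /=.
  by apply: plane_eq; rewrite ?rotation0 ?rotation1 mul0r cos0 sin0; ring.
rewrite IH -natr1 mulrDl mul1r addrC.
by apply: plane_eq; rewrite ?(rotation0, rotation1) cosD sinD; ring.
Qed.

Lemma rotation_full_turn (R : realType) (O : plane R) n x :
  (0 < n)%N -> iter n (rotation O (2 * pi / n%:R)) x = x.
Proof.
move=> n0; rewrite iter_rotation (_ : n%:R * _ = pi *+ 2); last first.
  by field; rewrite pnatr_eq0 -lt0n.
by apply: plane_eq; rewrite ?rotation0 ?rotation1 cos2pi sin2pi; ring.
Qed.

Lemma cos_neq1 (R : realType) (t : R) : 0 < t -> t < pi *+ 2 -> cos t != 1.
Proof.
have half (u : R) : 0 < u -> u <= pi -> cos u != 1.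
  move=> u0 upi; apply/eqP; rewrite -cos0 => /cos_inj.
  rewrite !in_itv/= (ltW u0) upi lexx pi_ge0 => /(_ isT isT) u0'.
  by rewrite u0' ltxx in u0.
move=> t0 t2; have [|tpi] := leP t pi; first exact: half.
(* Beyond [pi], the reflected angle [- t + pi *+ 2] falls back into the first case. *)
rewrite -cosN -cosD2pi; apply: half; lra.
Qed.

Lemma rotation_fixed (R : realType) (O x : plane R) (n k : nat) :
  (0 < k < n)%N -> iter k (rotation O (2 * pi / n%:R)) x = x -> x = O.
Proof.
move=> /andP[k0 kn]; rewrite iter_rotation; set t := k%:R * _ => E.
have n0 : 0 < n%:R :> R by rewrite ltr0n (leq_ltn_trans _ kn).
have ct : cos t < 1.
  rewrite lt_neqAle cos_le1 andbT; apply: cos_neq1.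
    by apply: mulr_gt0; rewrite ?ltr0n// divr_gt0// mulr_gt0// pi_gt0.
  rewrite /t mulrA ltr_pdivrMr//.
  have : k%:R < n%:R :> R by rewrite ltr_nat.
  by have := pi_gt0 R; nra.
have /= E0 := congr1 (fun z : plane R => z 0 0) E.
have /= E1 := congr1 (fun z : plane R => z 0 1) E.
rewrite rotation0 in E0; rewrite rotation1 in E1.
set a := x 0 0 - O 0 0 in E0 E1; set b := x 0 1 - O 0 1 in E0 E1.
(* Pairing the fixed point equations with [(a, b)] cancels the sine terms. *)
have H : (1 - cos t) * (a ^+ 2 + b ^+ 2) = 0.
  have h0 : cos t * a - sin t * b = a by move: E0; rewrite /a /b; lra.
  have h1 : sin t * a + cos t * b = b by move: E1; rewrite /a /b; lra.
  rewrite (_ : _ * _ = a * a + b * b - cos t * (a * a + b * b)); last by ring.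
  rewrite -{2}h0 -{3}h1; ring.
have /eqP : a ^+ 2 + b ^+ 2 = 0.
  by move/eqP: H; rewrite mulf_eq0 subr_eq0 eq_sym lt_eqF//= => /eqP.
rewrite paddr_eq0 ?sqr_ge0// !sqrf_eq0 /a /b !subr_eq0 => /andP[/eqP ? /eqP ?].
exact: plane_eq.
Qed.

Lemma invariant_continuum_center (R : realType) (O : plane R) (n : nat)
    (M : set (plane R)) :
  (1 < n)%N -> M !=set0 -> connected M -> liftable R M ->
  (forall x, M x -> M (rotation O (2 * pi / n%:R) x)) -> M O.
Proof.
move=> n1 [x0 Mx0] conM lM; set a := 2 * pi / n%:R; set g := rotation O a => gM.
apply: contrapT => nMO.
have d0 x : M x -> 0 < edist x O.
  move=> Mx; rewrite lt_neqAle edist_ge0 andbT eq_sym; apply/eqP => /edist_eq0 E.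
  by rewrite E in Mx.
pose c (x : plane R) := (x 0 0 - O 0 0) / edist x O.
pose s (x : plane R) := (x 0 1 - O 0 1) / edist x O.
have d2 (x : plane R) : (x 0 0 - O 0 0) ^+ 2 + (x 0 1 - O 0 1) ^+ 2 = edist x O ^+ 2.
  by rewrite edistE sqr_sqrtr// addr_ge0// sqr_ge0.
have cc i : continuous (fun x : plane R => x 0 i - O 0 i).
  by move=> x; exact: (cvgB (@coord_continuous R 1 2 0 i x) (cvg_cst _)).
have cd : continuous (fun x : plane R => edist x O).
  have -> : (fun x : plane R => edist x O) = Num.sqrt \o
      (fun x : plane R => (x 0 0 - O 0 0) ^+ 2 + (x 0 1 - O 0 1) ^+ 2).
    by apply/funext => x; rewrite edistE.
  move=> x; apply: continuous_comp; last exact: sqrt_continuous.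
  exact: (cvgD (cvgM (cc 0 x) (cc 0 x)) (cvgM (cc 1 x) (cc 1 x))).
have cdiv i : {within M, continuous (fun x : plane R => (x 0 i - O 0 i) / edist x O)}.
  apply: continuous_in_subspaceT => x /set_mem Mx.
  have dn0 : edist x O != 0 by rewrite gt_eqF// d0.
  exact: (cvgM (cc i x) (cvgV dn0 (cd x))).
have csM : unit_pair M c s.
  split.
  - exact: cdiv.
  - exact: cdiv.
  - move=> x Mx; rewrite /c /s !expr_div_n -mulrDl d2 divff//.
    by rewrite expf_neq0// gt_eqF// d0.
have [th cth thE] := lM _ _ csM.
have dg x : edist (g x) O = edist x O.
  by rewrite -{1}(rotation_center O a) rotation_isometry.
have gE x : M x -> cos (th (g x)) = cos (th x + a) /\ sin (th (g x)) = sin (th x + a).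
  move=> Mx; have [<- <-] := thE _ (gM _ Mx); have [E1 E2] := thE _ Mx.
  rewrite cosD sinD -E1 -E2 /c /s dg /g rotation0 rotation1.
  by split; field; rewrite gt_eqF// d0.
have cst x y : M x -> M y -> th (g x) - (th x + a) = th (g y) - (th y + a).
  apply: (@lift_diff_cst _ _ M (th \o g) (fun z => th z + a)) => //.
    apply: (within_continuous_comp _ cth) => //.
    exact/continuous_subspaceT/rotation_continuous.
  move/within_continuousP: cth => cth; apply/within_continuousP => z Mz.
  by apply: cvgD; [exact: cth|exact: cvg_cst].
(* Each application of [g] increases the angle by exactly [a + d], where [d] is a multiple of a full
   turn. Since [g] has period [n], the increment is 0 and [d = - a]; but [a] lies strictly between 0
   and a full turn. *)
pose d := th (g x0) - (th x0 + a).
have cd1 : cos d = 1.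
  by have [h1 h2] := gE _ Mx0; rewrite /d cosB h1 h2 -!expr2 cos2Dsin2.
have iterM k : M (iter k g x0) by elim: k => //= k; exact: gM.
have iterE k : th (iter k g x0) = th x0 + k%:R * (a + d).
  elim: k => [|k IH] /=; first by rewrite mul0r addr0.
  have := cst _ _ (iterM k) Mx0; rewrite -/d IH -natr1 => H.
  by rewrite mulrDl mul1r; lra.
have n0 : 0 < n%:R :> R by rewrite ltr0n ltnW.
have : n%:R * (a + d) = 0.
  by have := iterE n; rewrite rotation_full_turn 1?ltnW// => ?; lra.
move/eqP; rewrite mulf_eq0 gt_eqF//= => /eqP ad.
have da : d = - a by lra.
move: cd1; rewrite da cosN => /eqP; apply/negP/cos_neq1.
  by rewrite /a divr_gt0// mulr_gt0// pi_gt0.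
rewrite /a ltr_pdivrMr// -mulr_natr.
have : 2 <= n%:R :> R by rewrite ler_nat.
by have := pi_gt0 R; nra.
Qed.

(** The congruence absorbs the wrap-around of vertex indices, by periodicity of sine and cosine. *)
Lemma regular_polygon_iter (R : realType) (n : nat) (A : 'I_n -> plane R) (O : plane R)
    (i j : 'I_n) k :
  regular_polygon A O -> (i + k = j %[mod n])%N ->
  iter k (rotation O (2 * pi / n%:R)) (A i) = A j.
Proof.
move=> [r [t [r0 AE]]] ijk.
have n0 : (0 < n)%N := leq_ltn_trans (leq0n i) (ltn_ord i).
have nR : n%:R != 0 :> R by rewrite pnatr_eq0 -lt0n.
pose a : R := 2 * pi / n%:R.
have per q (x : R) : cos (x + (q * n)%N%:R * a) = cos x /\
    sin (x + (q * n)%N%:R * a) = sin x.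
  have -> : x + (q * n)%N%:R * a = x + q%:R * (pi *+ 2).
    by rewrite /a natrM -[pi *+ 2]mulr_natr; field.
  elim: q => [|q [IH1 IH2]]; first by rewrite mul0r addr0.
  by rewrite -natr1 mulrDl mul1r addrA cosD2pi sinD2pi.
have pt x : iter k (rotation O a) (O + r *: point (cos x) (sin x)) =
    O + r *: point (cos (x + k%:R * a)) (sin (x + k%:R * a)).
  rewrite iter_rotation; apply: plane_eq; rewrite ?rotation0 ?rotation1 !mxE/=.
    by rewrite cosD; ring.
  by rewrite sinD; ring.
rewrite -/a !AE -/a pt -addrA -mulrDl -natrD.
have red (l : nat) : point (cos (t + l%:R * a)) (sin (t + l%:R * a)) =
    point (cos (t + (l %% n)%N%:R * a)) (sin (t + (l %% n)%N%:R * a)).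
  rewrite {1 2}(divn_eq l n) addnC natrD mulrDl addrA.
  by have [-> ->] := per (l %/ n)%N (t + (l %% n)%:R * a).
by rewrite (red (i + k)%N) ijk -(red j).
Qed.

(** * The rotated copies of an arc *)

Section Star.
Context (R : realType) (T : pseudoMetricType R) (n : nat).
Variables (K : set T) (g : T -> T) (O : T) (f : R -> T) (u v : R).
Hypothesis hT : hausdorff_space T.
Hypothesis liftK : forall X, compact X -> X `<=` K -> liftable R X.
Hypothesis cg : continuous g.
Hypothesis injg : injective g.
Hypothesis gn : forall x, iter n g x = x.
Hypothesis gO : g O = O.
Hypothesis gfix : forall k x, (0 < k < n)%N -> iter k g x = x -> x = O.
Hypothesis uv : u < v.
Hypothesis cf : {within `[u, v], continuous f}.
Hypothesis injf : {in `[u, v] &, injective f}.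
Hypothesis fu : f u = O.
Hypothesis fK : forall k x, x \in `[u, v] -> K (iter k g (f x)).

Definition ray k : set T := (iter k g \o f) @` `[u, v].
Definition star : set T := \bigcup_(k in `I_n) ray k.

Let iterO k : iter k g O = O.
Proof. by elim: k => //= k ->. Qed.

Let cgk k : continuous (iter k g).
Proof.
elim: k => [|k IH] x /=; first exact: cvg_id.
by apply: (@continuous_comp _ _ _ (iter k g) g); [exact: IH|exact: cg].
Qed.

Let injgk k : injective (iter k g).
Proof. by elim: k => [|k IH] x y //= /injg /IH. Qed.

Let cray k : {within `[u, v], continuous (iter k g \o f)}.
Proof.
apply: (within_continuous_comp cf (B := setT)) => //.
exact/continuous_subspaceT/cgk.
Qed.

Let injray k : {in `[u, v] &, injective (iter k g \o f)}.
Proof. by move=> x y xI yI /injgk; exact: injf. Qed.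

Let uI : u \in `[u, v]. Proof. by rewrite in_itv/= lexx ltW. Qed.
Let vI : v \in `[u, v]. Proof. by rewrite in_itv/= lexx ltW. Qed.

Let subI x y : x \in `[u, v] -> y \in `[u, v] ->
  `[x, y]%classic `<=` `[u, v]%classic.
Proof.
rewrite !in_itv/= => /andP[? ?] /andP[? ?] z /=; rewrite !in_itv/=.
by move=> /andP[? ?]; apply/andP; split; lra.
Qed.

Lemma ray_compact k : compact (ray k).
Proof. exact: continuous_compact (@cray k) (@segment_compact _ _ _). Qed.

Lemma ray_connected k : connected (ray k).
Proof. exact: connected_continuous_connected (@segment_connected _ _ _) (@cray k). Qed.

Lemma ray_O k : ray k O.
Proof. by exists u => //=; rewrite fu iterO. Qed.

Lemma star_compact : compact star.
Proof.
rewrite /star bigcup_mkord; apply: bigsetU_compact => i _; exact: ray_compact.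
Qed.

Lemma star_connected : (0 < n)%N -> connected star.
Proof.
move=> n0; apply: bigcup_connected; first by exists O => k _; exact: ray_O.
by move=> k _; exact: ray_connected.
Qed.

(* With h = g^k, the arcs h f[u, t] and f[u, s] have the same end points, so
   h maps f[u, t] into f[u, s]; as h has finite order, f t lies in f[u, s]. *)
Let meet_le k s t : (0 < k < n)%N -> s \in `[u, v] -> t \in `[u, v] -> s <= t ->
  f s = iter k g (f t) -> f t = O.
Proof.
move=> kn sI tI st E; have us : u <= s by move: sI; rewrite in_itv/= => /andP[].
have ut := le_trans us st.
have cC : compact (f @` `[u, s]).
  apply: continuous_compact (@segment_compact _ _ _).
  exact: continuous_subspaceW (subI uI sI) cf.
have conC : connected (f @` `[u, s]).
  apply: connected_continuous_connected (@segment_connected _ _ _) _.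
  exact: continuous_subspaceW (subI uI sI) cf.
have crt : {within `[u, t], continuous (iter k g \o f)}.
  exact: continuous_subspaceW (subI uI tI) (@cray k).
have sub : (iter k g \o f) @` `[u, t] `<=` f @` `[u, s].
  apply: arc_in_continuum => //.
  - by move=> x y xI yI; apply: injray; [exact: subI xI|exact: subI yI].
  - by exists u => /=; [rewrite in_itv/= lexx|rewrite fu iterO].
  - by exists s => //=; rewrite in_itv/= us lexx.
  - apply: liftK.
      by apply: compactU => //; apply: continuous_compact crt (@segment_compact _ _ _).
    move=> _ [[x /= xI <-]|[x /= xI <-]].
      by apply: fK; exact: subI xI.
    by apply: (fK 0); exact: subI xI.
(* Since [s <= t], [sub] makes the [k]-th power of [g] map the piece up to [t] into itself. *)
have stab j x : x \in `[u, t] -> (f @` `[u, t]) (iter (j * k) g (f x)).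
  move=> xI; elim: j => [|j [y yI yE]]; first by exists x.
  rewrite mulSn iterD -yE.
  have [|z zI <-] := sub (iter k g (f y)); first by exists y.
  exists z => //; move: zI; rewrite /= !in_itv/= => /andP[-> /le_trans->//].
have kn0 : (0 < n)%N by case/andP: kn => _; case: (n).
have tT : t \in `[u, t] by rewrite in_itv/= lexx ut.
(* One more application of the [k]-th power completes [n * k] turns and returns to [f t], now inside
   the piece up to [s]; hence [s = t]. *)
have [y yI yE] := stab n.-1 t tT.
have [|z zI zE] := sub (iter k g (f y)); first by exists y.
have ftz : f z = f t.
  rewrite zE yE -iterD -mulSn prednK// mulnC.
  by elim: (k) => // j IH; rewrite mulSn iterD IH gn.
have zt : z = t.
  by apply: injf => //; apply: subI zI.
have st' : s = t.
  apply/eqP; rewrite eq_le st/= -zt.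
  by move: zI; rewrite /= in_itv/= => /andP[].
by apply: (gfix kn); rewrite -E st'.
Qed.

Let meet_O k s t : (0 < k < n)%N -> s \in `[u, v] -> t \in `[u, v] ->
  f s = iter k g (f t) -> f t = O.
Proof.
move=> kn sI tI E; have [st|ts] := leP s t; first exact: meet_le kn sI tI st E.
(* For [t < s] the roles are exchanged by the inverse power, with exponent [n - k]. *)
have fsO : f s = O.
  apply: (@meet_le (n - k) t s) => //; [|exact: ltW|].
    by case/andP: kn => k0 kn; rewrite subn_gt0 kn ltn_subrL k0 (ltn_trans k0 kn).
  by rewrite E -iterD subnK ?gn//; case/andP: kn => _ /ltnW.
by apply: (@injgk k); rewrite -E fsO iterO.
Qed.

Lemma ray_meet j k : (j < n)%N -> (k < n)%N -> j != k ->
  ray j `&` ray k `<=` [set O].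
Proof.
wlog jk : j k / (j < k)%N => [H|] jn kn jNk.
  have [jk|kj|E] := ltngtP j k; first exact: H.
    by rewrite setIC; apply: H => //; rewrite eq_sym.
  by rewrite E eqxx in jNk.
move=> x [[s /= sI sE] [t /= tI tE]].
have : f t = O.
  apply: (@meet_O (k - j) s t) => //.
    by rewrite subn_gt0 jk (leq_ltn_trans (leq_subr _ _) kn).
  by apply: (@injgk j); rewrite -iterD subnKC ?(ltnW jk)// sE tE.
by move=> ftO; rewrite -tE ftO /= iterO.
Qed.

Let fNO k x : x \in `[u, v] -> u < x -> iter k g (f x) <> O.
Proof.
move=> xI ux E; have : f x = f u by apply: (@injgk k); rewrite E fu iterO.
by move=> /(injf xI uI) xu; rewrite xu ltxx in ux.
Qed.

Let tip k : (ray k `\ O) (iter k g (f v)).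
Proof. by split; [exists v|exact: fNO]. Qed.

Let punctured_ray k : ray k `\ O = (iter k g \o f) @` `]u, v].
Proof.
apply/seteqP; split=> x.
  move=> [[t tI tE] /= xO]; exists t => //; move: tI.
  rewrite /= !in_itv/= le_eqVlt => /andP[/orP[/eqP ut|->->//]] _.
  by case: xO; rewrite -tE /= -ut fu iterO.
move=> [t tI <-]; have tI' : t \in `[u, v].
  by move: tI; rewrite /= !in_itv/= => /andP[/ltW -> ->].
split; first by exists t.
by apply: fNO => //; move: tI; rewrite /= in_itv/= => /andP[].
Qed.

Let sub_ray_connected k (I : interval R) : [set` I] `<=` `[u, v]%classic ->
  connected ((iter k g \o f) @` [set` I]).
Proof.
move=> Iuv; apply: connected_continuous_connected.
  by apply/connected_intervalP; exact: interval_is_interval.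
exact: continuous_subspaceW Iuv (@cray k).
Qed.

(** The punctured ray is connected. It is also clopen in the punctured star, because the other rays
    form a closed set that meets it only in [O]. *)
Let branch_O k x : (k < n)%N -> (ray k `\ O) x ->
  connected_component (star `\ O) x = ray k `\ O.
Proof.
move=> kn kx; apply/seteqP; split; last first.
  apply: connected_component_max => //.
    by move=> y [ky yO]; split=> //; exists k.
  rewrite punctured_ray; apply: sub_ray_connected => t /=.
  by rewrite !in_itv/= => /andP[/ltW -> ->].
move=> y [C [Cx CX conC] Cy]; have [yX yO] := CX _ Cy; split=> //.
suff E : C `&` ray k = C by move: Cy; rewrite -E => -[].
apply: conC.
- by exists x; split=> //; case: kx.
- exists (~` \bigcup_(j in `I_n `\ k) ray j).
    apply: closed_openC; apply: closed_bigcup => [|j _].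
      by apply: sub_finite_set (finite_II n) => j [].
    exact: compact_closed (@ray_compact j).
  apply/seteqP; split=> z [Cz kz]; split=> //.
    move=> [j [/= jn /eqP jk] jz]; have [_] := CX _ Cz; apply.
    by apply: (@ray_meet j k).
  have [[j jn jz] _] := CX _ Cz; have [<-//|jk] := eqVneq j k.
  by exfalso; apply: kz; exists j => //; split=> //; exact/eqP.
- exists (ray k) => //; exact: compact_closed (@ray_compact k).
Qed.

Lemma star_branches : (branches O star #= `I_n)%card.
Proof.
have -> : branches O star = (fun k => ray k `\ O) @` `I_n.
  apply/seteqP; split=> [_ [x [[k kn kx] xO] <-]|_ [k kn <-]].
    by exists k => //; rewrite (@branch_O k).
  exists (iter k g (f v)); last exact: branch_O.
  by have [kx kO] := tip k; split=> //; exists k.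
apply: inj_card_eq => j k /set_mem jn /set_mem kn E; apply/eqP/negPn/negP => jk.
have [jx xO] := tip j; have [kx _] : (ray k `\ O) (iter j g (f v)).
  by rewrite -E; exact: tip.
by apply: xO; apply: (@ray_meet j k).
Qed.

(** Removing [p] from its ray leaves two connected parts: [D1], with everything joined to [O], and
    [D2], the outer end of the ray. *)
Lemma star_not_ramification p : star p -> p <> O ->
  ~ (`I_3 #<= branches p star)%card.
Proof.
move=> [k kn [t tI tp]] pO; have tI' := tI; rewrite /= in_itv/= in tI'.
case/andP: tI' => ut tv.
have {ut}ut : u < t.
  rewrite lt_neqAle ut andbT; apply/eqP => utE.
  by apply: pO; rewrite -tp/= -utE fu iterO.
have np s : s \in `[u, v] -> s != t -> iter k g (f s) <> p.
  move=> sI /eqP st sp; apply: st; apply: (@injray k) => //=; by rewrite sp -tp.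
pose D1 := \bigcup_(j in `I_n)
  (if j == k then (iter k g \o f) @` `[u, t[ else ray j).
pose D2 := (iter k g \o f) @` `]t, v].
have sub1 : `[u, t[%classic `<=` `[u, v]%classic.
  by move=> x /=; rewrite !in_itv/= => /andP[-> /ltW /le_trans->].
have sub2 : `]t, v]%classic `<=` `[u, v]%classic.
  by move=> x /=; rewrite !in_itv/= => /andP[/ltW /(le_trans (ltW ut)) -> ->].
have D1E : D1 `<=` star `\ p.
  move=> x [j jn]; case: eqP => [jk [s sI sx]|/eqP jk jx].
    split; first by exists k => //; exists s => //; exact: sub1.
    rewrite /= -sx; apply: np; first exact: sub1.
    by move: sI; rewrite /= in_itv/= => /andP[_ /lt_eqF ->].
  split; first by exists j.
  move=> /= xp; apply: pO; rewrite -xp; apply: (@ray_meet j k) => //.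
  by split=> //; rewrite xp -tp; exists t.
have D2E : D2 `<=` star `\ p.
  move=> x [s sI sx]; split; first by exists k => //; exists s => //; exact: sub2.
  rewrite /= -sx; apply: np; first exact: sub2.
  by move: sI; rewrite /= in_itv/= => /andP[/gt_eqF ->].
have D12 : star `\ p `<=` D1 `|` D2.
  move=> x [[j jn jx] xp]; have [jk|jk] := eqVneq j k; last first.
    by left; exists j => //; rewrite (negbTE jk).
  move: jx; rewrite jk => -[s sI sx].
  have [st|ts|st] := ltgtP s t; last by case: xp; rewrite /= -sx /= st -tp.
    left; exists k => //; rewrite eqxx; exists s => //.
    by move: sI; rewrite /= !in_itv/= st => /andP[->].
  by right; exists s => //; move: sI; rewrite /= !in_itv/= ts => /andP[_ ->].
have O1 j : (if j == k then (iter k g \o f) @` `[u, t[ else ray j) O.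
  case: ifP => _; last exact: ray_O.
  by exists u; rewrite /= ?in_itv/= ?lexx// fu iterO.
have con1 : connected D1.
  apply: bigcup_connected; first by exists O => j _; exact: O1.
  move=> j _; case: ifP => _; last exact: ray_connected.
  exact: sub_ray_connected.
have con2 : connected D2 by exact: sub_ray_connected.
pose y := iter k g (f v).
(* If [p] is the tip of its ray, [D2] is empty and the second value is spare; only an upper bound on
   the number of branches is wanted. *)
pose h (i : nat) := connected_component (star `\ p) (if i is 0%N then O else y).
suff sub : branches p star `<=` h @` `I_2.
  move=> H; have := card_le_trans H (subset_card_le sub).
  move=> /card_le_trans /(_ (card_image_le _ _)).
  by rewrite card_le_II.
move=> _ [x /D12[D1x|D2x] <-].
  exists 0%N => //; apply: same_connected_component.
  by apply: (connected_component_max _ D1E con1) D1x; exists k => //; exact: O1.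
exists 1%N => //; apply: same_connected_component.
have [s sI _] := D2x; apply: (connected_component_max _ D2E con2) D2x.
exists v => //=; rewrite in_itv/= lexx andbT.
by move: sI; rewrite /= in_itv/= => /andP[/lt_le_trans h1 /h1].
Qed.

End Star.

(** * Position and symmetry of the attractor *)

Lemma attractor_sub_polygon (R : realType) (n m : nat) (A : 'I_n -> plane R)
    (S : 'I_m -> plane R -> plane R) (K : set (plane R)) :
  contractible_polygonal_system A S -> attractor S K -> (0 < n)%N ->
  K `<=` polygon A.
Proof.
move=> [cS SP _ _ _] [_ cK KS]; case: n A SP => // n A SP _.
apply: (sub_attracting cS cK) => //.
- exact: compact_closed (@norm_hausdorff _ _) (@polygon_compact _ _ _).
- exists (A ord0), (fun k => (k == ord0)%:R); split=> [k||].
  + exact: ler0n.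
  + by rewrite (bigD1 ord0)//= big1 ?addr0// => k /negbTE ->.
  + rewrite (bigD1 ord0)//= scale1r big1 ?addr0// => k /negbTE ->.
    by rewrite scale0r.
- by rewrite {1}KS.
Qed.

Lemma attractor_rotation (R : realType) (n m : nat) (O : plane R)
    (S : 'I_m -> plane R -> plane R) (K : set (plane R)) :
  (forall i, contracting_similarity (S i)) -> attractor S K -> (0 < n)%N ->
  symmetric_system (rotation_group n O) S ->
  forall x, K x -> K (rotation O (2 * pi / n%:R) x).
Proof.
move=> cS [K0 cK KS] n0 sym; set g := rotation _ _.
have modn_g k x : iter k g x = iter (k %% n) g x.
  rewrite {1}(divn_eq k n) addnC iterD; congr iter.
  elim: (k %/ n)%N => // q IH; by rewrite mulSn iterD IH rotation_full_turn.
have cgk k : {within K, continuous (iter k g)}.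
  rewrite (_ : iter k g = rotation O (k%:R * (2 * pi / n%:R))).
    exact/continuous_subspaceT/rotation_continuous.
  by apply/funext => x; exact: iter_rotation.
(* The symmetry gives no control over the power [g'] on the right, so all powers are taken at once:
   the union is covered by its own images under the system, and [sub_attracting] puts it inside
   [K]. *)
pose K' := \bigcup_(k : 'I_n) (iter k g @` K).
have K'g k x : K x -> K' (iter k g x).
  move=> Kx; exists (Ordinal (ltn_pmod k n0)) => //; exists x => //=.
suff sub : K' `<=` K by move=> x Kx; apply: sub; exact: (K'g 1).
apply: (sub_attracting cS) => //.
- by apply: finite_bigcup_compact => k; exact: continuous_compact (cgk k) cK.
- exact: compact_closed (@norm_hausdorff _ _) cK.
- move=> _ [k _ [x Kx <-]]; move: Kx; rewrite KS => -[i _ [y Ky <-]].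
  have [_ [j [[k' ->] E]]] := sym (iter k g) i (ex_intro _ (nat_of_ord k) erefl).
  have /= -> := congr1 (fun h => h y) E; exists j => //.
  by exists (iter k' g y) => //; exact: K'g.
- by move=> i; rewrite {2}KS => x Kx; exists i.
Qed.

Lemma arc_sub_continuum (R : realType) (K C c : set (plane R)) x y :
  (forall T, compact T -> T `<=` K -> liftable R T) ->
  jordan_arc x y c -> c `<=` K -> compact C -> connected C -> C `<=` K ->
  C x -> C y -> c `<=` C.
Proof.
move=> lK [f [cf inj f0 f1 ->]] cK cC conC CK Cx Cy.
have hR : hausdorff_space (plane R) by exact: norm_hausdorff.
apply: (arc_in_continuum hR ler01 cf inj); rewrite ?f0 ?f1//.
apply: lK; last by move=> z [/cK|/CK].
by apply: compactU => //; apply: continuous_compact cf (@segment_compact _ _ _).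
Qed.

Lemma jordan_arc_image (R : realType) (g : plane R -> plane R) x y c :
  continuous g -> injective g -> jordan_arc x y c ->
  jordan_arc (g x) (g y) (g @` c).
Proof.
move=> cg ig [f [cf inj <- <- ->]]; exists (g \o f); split=> //.
- by apply: (within_continuous_comp cf (B := setT)) => //; exact: continuous_subspaceT.
- by move=> s t sI tI /ig; exact: inj.
- by rewrite image_comp.
Qed.

Lemma jordan_arc_compact (R : realType) (x y : plane R) c :
  jordan_arc x y c -> compact c.
Proof.
by move=> [f [cf _ _ _ ->]]; apply: continuous_compact cf (@segment_compact _ _ _).
Qed.

Lemma jordan_arc_connected (R : realType) (x y : plane R) c :
  jordan_arc x y c -> connected c.
Proof.
move=> [f [cf _ _ _ ->]].
exact: connected_continuous_connected (@segment_connected _ _ _) cf.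
Qed.

Lemma jordan_arc_ends (R : realType) (x y : plane R) c :
  jordan_arc x y c -> c x /\ c y.
Proof.
move=> [f [_ _ <- <- ->]]; split; first by exists 0 => //=; rewrite in_itv/= lexx ler01.
by exists 1 => //=; rewrite in_itv/= lexx ler01.
Qed.

(** * The main tree *)

Section MainTree.
Context (R : realType) (n : nat) (A : 'I_n -> plane R) (K : set (plane R)).
Variable arc : 'I_n -> 'I_n -> set (plane R).
Hypothesis n1 : (1 < n)%N.
Hypothesis lK : forall T, compact T -> T `<=` K -> liftable R T.
Hypothesis arcP : arcs_between_vertices A K arc.

Lemma main_tree_sub : main_tree arc `<=` K.
Proof. by move=> x [[i j] /= ij]; have [_] := arcP ij; apply. Qed.

Lemma exists_neq (i : 'I_n) : exists j : 'I_n, i != j.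
Proof.
have [->|i0] := eqVneq i (Ordinal (ltnW n1)); first by exists (Ordinal n1).
by exists (Ordinal (ltnW n1)).
Qed.

Lemma vertex_main_tree i : main_tree arc (A i).
Proof.
have [j ij] := exists_neq i; exists (i, j) => //=.
by have [aij _] := arcP ij; have [] := jordan_arc_ends aij.
Qed.

(** With compactness and connectedness below, this characterises the main tree as the smallest
    subcontinuum of [K] through all vertices. *)
Lemma main_tree_min (C : set (plane R)) :
  compact C -> connected C -> C `<=` K -> (forall i, C (A i)) ->
  main_tree arc `<=` C.
Proof.
move=> cC conC CK CA x [[i j] /= ij]; have [arcij sub] := arcP ij.
exact: (arc_sub_continuum lK arcij).
Qed.

Lemma main_tree_compact : compact (main_tree arc).
Proof.
have -> : main_tree arc =
    \bigcup_(ij : 'I_n * 'I_n) (if ij.1 == ij.2 then set0 else arc ij.1 ij.2).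
  apply/seteqP; split=> x [[i j] /=].
    by move=> ij ijx; exists (i, j) => //=; rewrite (negbTE ij).
  by case: ifPn => // ij _ ijx; exists (i, j).
apply: finite_bigcup_compact => -[i j] /=; case: ifPn => [_|ij].
  exact: compact0.
by have [aij _] := arcP ij; exact: jordan_arc_compact aij.
Qed.

(** The fan [D] of arcs from one vertex is already a continuum through all vertices, so by
    minimality it is the whole tree. *)
Lemma main_tree_connected : connected (main_tree arc).
Proof.
pose i0 := Ordinal (ltnW n1).
pose D := \bigcup_(j in [set j | i0 != j]) arc i0 j.
have DM : D `<=` main_tree arc by move=> x [j ij jx]; exists (i0, j).
have DA i : D (A i).
  have [<-|ij] := eqVneq i0 i.
    have [j ij] := exists_neq i0; exists j => //.
    by have [aij _] := arcP ij; have [] := jordan_arc_ends aij.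
  by exists i => //; have [aij _] := arcP ij; have [] := jordan_arc_ends aij.
have conD : connected D.
  apply: bigcup_connected.
    exists (A i0) => j ij; have [aij _] := arcP ij.
    by have [] := jordan_arc_ends aij.
  by move=> j ij; have [aij _] := arcP ij; exact: jordan_arc_connected aij.
have cD : compact D.
  have -> : D = \bigcup_j (if i0 == j then set0 else arc i0 j).
    apply/seteqP; split=> x [j /=].
      by move=> ij ijx; exists j => //=; rewrite (negbTE ij).
    by case: ifPn => // ij _ ijx; exists j.
  apply: finite_bigcup_compact => j; case: ifPn => [_|ij]; first exact: compact0.
  by have [aij _] := arcP ij; exact: jordan_arc_compact aij.
suff -> : main_tree arc = D by [].
apply/seteqP; split=> //; apply: main_tree_min => //.
exact: subset_trans DM main_tree_sub.
Qed.

End MainTree.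

(** * The main tree as a star *)

Theorem proposition2 (R : realType) (n m : nat) (A : 'I_n -> plane R)
    (O : plane R) (S : 'I_m -> plane R -> plane R) (K : set (plane R))
    (arc : 'I_n -> 'I_n -> set (plane R)) :
  (3 <= n)%N ->
  regular_polygon A O ->
  contractible_polygonal_system A S ->
  symmetric_system (rotation_group n O) S ->
  attractor S K ->
  arcs_between_vertices A K arc ->
  [set p | ramification_point (main_tree arc) p] = [set O] /\
  (branches O (main_tree arc) #= `I_n)%card.
Proof.
move=> n3 regA cps sym attK arcP.
have n0 : (0 < n)%N by exact: leq_trans n3.
have n1 : (1 < n)%N by exact: leq_trans n3.
have KA k : K (A k) by exact: (main_tree_sub arcP (vertex_main_tree n1 arcP k)).
have lK := attractor_liftable cps attK KA (attractor_sub_polygon cps attK n0).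
set M := main_tree arc; pose g := rotation O (2 * pi / n%:R).
have MK : M `<=` K := main_tree_sub arcP.
have cM : compact M := main_tree_compact arcP.
have conM : connected M := main_tree_connected n1 lK arcP.
have MA : forall i, M (A i) := vertex_main_tree n1 arcP.
have cg : continuous g by exact: rotation_continuous.
have ig : injective g by exact: rotation_inj.
have gK : forall x, K x -> K (g x).
  by apply: attractor_rotation attK n0 sym; case: cps.
have gA i : M (g (A i)).
  have -> : g (A i) = A (Ordinal (ltn_pmod i.+1 n0)).
    by apply: (@regular_polygon_iter _ _ _ _ _ _ 1) => //=; rewrite addn1 modn_mod.
  exact: MA.
(* The rotated arc is an arc of [K] whose ends are vertices, so it stays in the continuum [M]. *)
have gM x : M x -> M (g x).
  move=> [[i j] /= ij ijx]; have [arcij sub] := arcP _ _ ij.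
  have := jordan_arc_image cg ig arcij => garc.
  have gsub : g @` arc i j `<=` K by move=> _ [z /sub Kz <-]; exact: gK.
  by apply: (arc_sub_continuum lK garc gsub cM conM MK (gA i) (gA j)); exists x.
have MO : M O.
  apply: (@invariant_continuum_center _ _ n) => //; last exact: lK.
  by exists (A (Ordinal n0)).
(* The generating arc of the star is the part of this arc from [O], at parameter [u], to the vertex
   [A j]. It is nondegenerate because [A j] is not the center. *)
have [[i j] /= ij ijO] := MO; have [[f [cf inj f0 f1 arcE]] arcK] := arcP _ _ ij.
have arcM : arc i j `<=` M by move=> x ijx; exists (i, j).
move: ijO; rewrite arcE => -[u uI fu].
have AO : A j <> O.
  have [r [t [r0 /(_ j) ->]]] := regA => E.
  have := cos2Dsin2 (t + j%:R * (2 * pi / n%:R)); set c := cos _; set s := sin _.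
  have := congr1 (fun z : plane R => z 0 0) E; rewrite !mxE/= -/c => Ec.
  have := congr1 (fun z : plane R => z 0 1) E; rewrite !mxE/= -/s => Es.
  have -> : c = 0 by apply: (mulfI (lt0r_neq0 r0)); lra.
  have -> : s = 0 by apply: (mulfI (lt0r_neq0 r0)); lra.
  by rewrite expr0n addr0 => /eqP; rewrite eq_sym oner_eq0.
move: (uI); rewrite /= in_itv/= => /andP[u0 u1].
have {u1}u1 : u < 1.
  rewrite lt_neqAle u1 andbT; apply/eqP => uE.
  by apply: AO; rewrite -f1 -fu uE.
have sub : `[u, 1]%classic `<=` `[0, 1]%classic.
  by move=> x /=; rewrite !in_itv/= => /andP[/(le_trans u0) -> ->].
have cfu : {within `[u, 1], continuous f} := continuous_subspaceW sub cf.
have injfu : {in `[u, 1] &, injective f}.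
  by move=> x y xI yI; apply: inj; exact: sub.
have fM k x : x \in `[u, 1] -> M (iter k g (f x)).
  move=> xI; elim: k => [|k IH] /=; last exact: gM.
  by apply: arcM; rewrite arcE; exists x => //; exact: sub.
have fK k x : x \in `[u, 1] -> K (iter k g (f x)).
  by move=> xI; apply: MK; exact: fM.
have gn x : iter n g x = x by exact: rotation_full_turn.
have gO : g O = O by exact: rotation_center.
have gfix k x : (0 < k < n)%N -> iter k g x = x -> x = O.
  exact: rotation_fixed.
have hR : hausdorff_space (plane R) by exact: norm_hausdorff.
(* The star lies in [M] by invariance; conversely it is a continuum in [K] through all vertices, so
   minimality applies. *)
have starM : star n g f u 1 = M.
  apply/seteqP; split=> [x [k kn [s sI <-]]|]; first exact: fM.
  apply: (main_tree_min lK arcP).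
  - exact: star_compact.
  - exact: (star_connected cg gO u1 cfu fu).
  - by move=> x [k kn [s sI <-]]; exact: fK.
  (* The power taking [A j] to [A l]; adding [n] keeps the natural subtraction from truncating. *)
  - move=> l; pose k := ((l + n - j) %% n)%N.
    exists k; first exact: ltn_pmod.
    exists 1; first by rewrite /= in_itv/= lexx (ltW u1).
    rewrite /= f1; apply: regular_polygon_iter regA _.
    rewrite /k modnDmr subnKC ?modnDr//.
    exact: leq_trans (ltnW (ltn_ord j)) (leq_addl _ _).
have brO : (branches O M #= `I_n)%card.
  by rewrite -starM; apply: (@star_branches _ _ _ K).
split=> //; apply/seteqP; split=> [p [Mp br3]|_ ->].
  apply: contrapT => pO; rewrite -starM in Mp br3.
  exact: (star_not_ramification hR lK cg ig gn gO gfix u1 cfu injfu fu fK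
    Mp pO br3).
have [_ nbr] := (card_eqPle _ _).1 brO.
by split=> //; apply: card_le_trans nbr; rewrite card_le_II.
Qed.
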